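(* Let $J:\mathbb{R}^n\to\mathbb{R}$ be of class $C^2$ and let $\mathfrak{f}_1,\mathfrak{f}_2:\mathbb{R}^n\to\mathbb{R}$, of the form $\mathfrak{f}_i(x)=f_i(J(x))$ with $f_i:\mathbb{R}\to\mathbb{R}$, $i=1,2$, be of class $C^2$. Assume that $J$ is radially unbounded and that there exists $x^*\in\mathbb{R}^n$ such that $\nabla_xJ(x)^\top(x-x^* )>0$ for all $x\in\mathbb{R}^n\setminus\{x^*\}$. Consider one of the following two algorithms with step size parameter $h>0$ and switched vector field $g_k$ built from $\mathfrak{f}_1,\mathfrak{f}_2$ (see context): (a) the Euler version $x_{k+1}=E_{g_k}^{\sqrt h}(x_k)$, in which case assume that for all $x\in\mathbb{R}^n$ $$-\nabla_xJ(x)=[\mathfrak{f}_1,\mathfrak{f}_2](x)-\nabla_x\mathfrak{f}_1(x)\mathfrak{f}_1(x)-\nabla_x\mathfrak{f}_2(x)\mathfrak{f}_2(x);$$ (b) the Heun version $x_{k+1}=H_{g_k}^{\sqrt h}(x_k)$, in which case assume that for all $x\in\mathbb{R}^n$ $$-\nabla_xJ(x)=[\mathfrak{f}_1,\mathfrak{f}_2](x).$$ Then, in each of the cases (a) and (b), for all $0<\delta_2<\delta_1$ there exists an $h^*>0$ such that for all $h\in(0,h^* )$ and all initial conditions $x_0\in\mathcal{S}_{x^*}^{\delta_1}$, $x_k$ converges to $\mathcal{S}_{x^*}^{\delta_2}$ as $k\to\infty$.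
   Context: Notation: $n\ge 1$; $\mathbb{N}_0=\{0,1,2,\dots\}$; $|\cdot|$ is the Euclidean norm; $C^m$ denotes the set of $m$-times differentiable functions; for $f:\mathbb{R}^n\to\mathbb{R}$, $\nabla_xf(x):=\left(\frac{\partial f}{\partial x}(x)\right)^\top\in\mathbb{R}^n$ is the gradient (column vector). For $\delta\in(0,\infty)$, $\mathcal{S}_{x^*}^{\delta}:=\{x\in\mathbb{R}^n:|x-x^*|\le\delta\}$. $J$ radially unbounded means $J(x)\to\infty$ as $|x|\to\infty$. For a sequence $x_k$, convergence to a set means that the distance of $x_k$ to the set tends to $0$ as $k\to\infty$. Bracket: for scalar functions $\mathfrak{f}_1,\mathfrak{f}_2:\mathbb{R}^n\to\mathbb{R}$, $[\mathfrak{f}_1,\mathfrak{f}_2](x):=\nabla_x\mathfrak{f}_2(x)\,\mathfrak{f}_1(x)-\nabla_x\mathfrak{f}_1(x)\,\mathfrak{f}_2(x)\in\mathbb{R}^n$. Integration maps: for a vector field $g:\mathbb{R}^n\to\mathbb{R}^n$ and a step $s>0$, $$E_g^{s}(x):=x+s\,g(x),\qquad H_g^{s}(x):=x+\tfrac{s}{2}\left(g(x)+g(x+s\,g(x))\right).$$ Switched vector field: for $k\in\mathbb{N}_0$ put $l=(\lfloor k/4\rfloor \bmod n)+1$, let $e_l$ be the $l$-th unit vector of $\mathbb{R}^n$, and set $$g_k(x)=\begin{cases}\ \ \mathfrak{f}_1(x)e_l & k\bmod 4=0\\ \ \ \mathfrak{f}_2(x)e_l & k\bmod 4=1\\ -\mathfrak{f}_1(x)e_l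 & k\bmod 4=2\\ -\mathfrak{f}_2(x)e_l & k\bmod 4=3.\end{cases}$$ The algorithms use the step $s=\sqrt h$ and are run for $k=0,1,2,\dots$ from the initial condition $x_0$. *)

(* Defs.v *)
From HB Require Import structures.
From mathcomp Require Import all_boot all_order all_algebra.
From mathcomp Require Import all_classical all_reals all_analysis.

Set Implicit Arguments.
Unset Strict Implicit.
Unset Printing Implicit Defensive.
Import Order.TTheory GRing.Theory Num.Theory.
Import numFieldNormedType.Exports.

Local Open Scope classical_set_scope.
Local Open Scope ring_scope.

(* R^n is the type 'cV[R]_n of column vectors.  Its library norm is the
   sup norm, so the Euclidean norm is defined separately; differentiability
   is insensitive to the choice of norm. *)
Definition enorm (R : realType) (n : nat) (x : 'cV[R]_n) : R :=
  Num.sqrt (\sum_(i < n) x i 0 ^+ 2).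

Definition eball (R : realType) (n : nat) (c : 'cV[R]_n) (r : R) :
    set 'cV[R]_n :=
  [set x | enorm (x - c) <= r].

Definition dist_to_set (R : realType) (n : nat) (A : set 'cV[R]_n)
    (x : 'cV[R]_n) : R :=
  inf [set enorm (x - y) | y in A].

Definition cvg_to_set (R : realType) (n : nat) (x : nat -> 'cV[R]_n)
    (A : set 'cV[R]_n) : Prop :=
  dist_to_set A (x k) @[k --> \oo] --> (0 : R).

(* The l-th coordinate vector, l counted from 0; zero when n <= l. *)
Definition unit_vec (R : realType) (n l : nat) : 'cV[R]_n :=
  \col_(i < n) (i == l :> nat)%:R.

Definition gradient (R : realType) (n : nat) (f : 'cV[R]_n -> R)
    (x : 'cV[R]_n) : 'cV[R]_n :=
  \col_(i < n) 'D_(unit_vec R n i) f x.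

(* The class C^2 is taken to mean twice (Frechet) differentiable, without
   requiring the second derivative to be continuous; in particular every
   twice continuously differentiable function satisfies it. *)
Definition twice_differentiable (R : realType) (n : nat)
    (f : 'cV[R]_n -> R) : Prop :=
  (forall x, differentiable f x) /\ (forall x, differentiable (gradient f) x).

Definition radially_unbounded (R : realType) (n : nat)
    (J : 'cV[R]_n -> R) : Prop :=
  forall M : R, exists r : R, forall x : 'cV[R]_n, r < enorm x -> M < J x.

Definition bracket (R : realType) (n : nat) (F1 F2 : 'cV[R]_n -> R)
    (x : 'cV[R]_n) : 'cV[R]_n :=
  F1 x *: gradient F2 x - F2 x *: gradient F1 x.

Definition euler_map (R : realType) (n : nat) (g : 'cV[R]_n -> 'cV[R]_n)
    (s : R) (x : 'cV[R]_n) : 'cV[R]_n :=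
  x + s *: g x.

Definition heun_map (R : realType) (n : nat) (g : 'cV[R]_n -> 'cV[R]_n)
    (s : R) (x : 'cV[R]_n) : 'cV[R]_n :=
  x + (s / 2) *: (g x + g (x + s *: g x)).

Definition switched_field (R : realType) (n : nat) (F1 F2 : 'cV[R]_n -> R)
    (k : nat) (x : 'cV[R]_n) : 'cV[R]_n :=
  let e := unit_vec R n ((k %/ 4) %% n)%N in
  match (k %% 4)%N with
  | 0 => F1 x *: e
  | 1 => F2 x *: e
  | 2 => - (F1 x *: e)
  | _ => - (F2 x *: e)
  end.

Definition is_trajectory (R : realType) (n : nat)
    (step : ('cV[R]_n -> 'cV[R]_n) -> R -> 'cV[R]_n -> 'cV[R]_n)
    (g : nat -> 'cV[R]_n -> 'cV[R]_n) (h : R) (x : nat -> 'cV[R]_n) : Prop :=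
  forall k : nat, x k.+1 = step (g k) (Num.sqrt h) (x k).

Definition practically_convergent (R : realType) (n : nat)
    (step : ('cV[R]_n -> 'cV[R]_n) -> R -> 'cV[R]_n -> 'cV[R]_n)
    (g : nat -> 'cV[R]_n -> 'cV[R]_n) (xs : 'cV[R]_n) : Prop :=
  forall d1 d2 : R, 0 < d2 -> d2 < d1 ->
  exists2 hs : R, 0 < hs &
    forall h : R, 0 < h -> h < hs ->
    forall x : nat -> 'cV[R]_n, eball xs d1 (x 0%N) ->
    is_trajectory step g h x -> cvg_to_set x (eball xs d2).

(* Main.v *)
(* Four steps along one coordinate move a point x to x + s^2 w e_l, where
   s = sqrt h and w tends to - d_l J(xb) as (x, s) tends to (xb, 0): the terms
   of order s cancel and the quotients of increments of F1 and F2 leave the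
   bracket (for the Euler map, minus the two self-interaction terms). A sweep
   over all coordinates is therefore x + h v with v --> - grad J(xb), a
   perturbed gradient step. The convergence being joint in (x, s), it is uniform
   on compact sets, so for small h every sweep lowers J by at least h eta on any
   compact set that avoids xs, the strict minimiser of J and its only possible
   critical point.
   Hence J eventually enters, and never again leaves, a sublevel set inside the
   target ball; the intermediate points of a sweep stay close to its start. *)

Require Import Defs.
From HB Require Import structures.
From mathcomp Require Import all_boot all_order all_algebra.
From mathcomp Require Import all_classical all_reals all_analysis.
From mathcomp Require Import ring lra zify.
Import Order.TTheory GRing.Theory Num.Theory.
Import numFieldNormedType.Exports.
Local Open Scope classical_set_scope.
Local Open Scope ring_scope.

Set Implicit Arguments.
Unset Strict Implicit.
Unset Printing Implicit Defensive.

(** * Dot product and limits of column vectors *)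

(** A matrix product, so that it unfolds to the form of the gradient hypothesis in the theorem. *)
Definition dot {R : realType} {n : nat} (u v : 'cV[R]_n) : R := (u^T *m v) 0 0.

Lemma dotE (R : realType) (n : nat) (u v : 'cV[R]_n) :
  dot u v = \sum_i u i 0 * v i 0.
Proof. by rewrite /dot mxE; apply: eq_bigr => i _; rewrite mxE. Qed.

Lemma dotZr (R : realType) (n : nat) (a : R) (u v : 'cV[R]_n) :
  dot u (a *: v) = a * dot u v.
Proof. by rewrite /dot -scalemxAr mxE. Qed.

Lemma dotNr (R : realType) (n : nat) (u v : 'cV[R]_n) : dot u (- v) = - dot u v.
Proof. by rewrite -scaleN1r dotZr mulN1r. Qed.

Lemma dot_unit (R : realType) (n : nat) (u : 'cV[R]_n) (l : 'I_n) :
  dot u (unit_vec R n l) = u l 0.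
Proof.
rewrite dotE (bigD1 l) //= mxE eqxx mulr1 big1 ?addr0// => i il.
by rewrite mxE (negbTE (il : (i : nat) != l)) mulr0.
Qed.

Lemma dot_gt0 (R : realType) (n : nat) (u : 'cV[R]_n) : u != 0 -> 0 < dot u u.
Proof.
have s0 (i : 'I_n) : true -> 0 <= u i 0 * u i 0 by rewrite -expr2 sqr_ge0.
move=> u0; rewrite dotE lt_neqAle sumr_ge0// andbT eq_sym.
apply: contra u0 => /eqP /psumr_eq0P u0; apply/eqP/matrixP => i j.
by rewrite (ord1 j) mxE; apply/eqP; rewrite -sqrf_eq0 expr2 u0.
Qed.

(** A neighbourhood of [l] contains a box of neighbourhoods of its finitely many entries. *)
Lemma cvg_col (R : realType) (n : nat) (T : Type) (G : set_system T)
    {FG : Filter G} (f : T -> 'cV[R]_n) (l : 'cV[R]_n) :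
  (forall i, f t i 0 @[t --> G] --> l i 0) -> f t @[t --> G] --> l.
Proof.
move=> fl A [P lP PA].
have : \forall t \near G, forall i, P i 0 (f t i 0).
  by apply: filter_forall => i; exact: fl (lP i 0).
by apply: filterS => t Pt; apply: PA => i j; rewrite (ord1 j); exact: Pt.
Qed.

Lemma cvg_coord (R : realType) (n : nat) (T : Type) (G : set_system T)
    {FG : Filter G} (f : T -> 'cV[R]_n) (l : 'cV[R]_n) (i : 'I_n) :
  f t @[t --> G] --> l -> f t i 0 @[t --> G] --> l i 0.
Proof.
by move=> fl; exact: (cvg_comp _ _ fl (@coord_continuous R n 1 i 0 l)).
Qed.

Lemma cvg_dot (R : realType) (n : nat) (T : Type) (G : set_system T)
    {FG : Filter G} (f g : T -> 'cV[R]_n) (a b : 'cV[R]_n) :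
  f t @[t --> G] --> a -> g t @[t --> G] --> b ->
  dot (f t) (g t) @[t --> G] --> dot a b.
Proof.
move=> fa gb; rewrite dotE.
under eq_fun do rewrite dotE.
apply: cvg_big => [|i _]; first by move=> x; exact: add_continuous.
by apply: cvgM; apply: cvg_coord.
Qed.

Lemma col_sum_unit (R : realType) (n : nat) (u : 'cV[R]_n) :
  u = \sum_(i < n) u i 0 *: unit_vec R n i.
Proof.
apply/matrixP => i j; rewrite (ord1 j) summxE (bigD1 i)//= !mxE eqxx mulr1.
rewrite big1 ?addr0// => k ki; rewrite !mxE.
by rewrite eq_sym (negbTE (ki : (k : nat) != i)) mulr0.
Qed.

(** * Gradients, mean values and difference quotients *)

Lemma diff_gradient (R : realType) (n : nat) (f : 'cV[R]_n -> R)
    (x u : 'cV[R]_n) :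
  differentiable f x -> 'd f x u = dot (gradient f x) u.
Proof.
move=> df; rewrite {1}(col_sum_unit u) linear_sum dotE; apply: eq_bigr => i _.
by rewrite linearZ /= mxE deriveE// mulrC.
Qed.

(** The one-variable mean value theorem for [r |-> f (x + r *: u)] on [[0, 1]]. *)
Lemma gradient_mean_value (R : realType) (n : nat) (f : 'cV[R]_n -> R)
    (x u : 'cV[R]_n) : (forall z, differentiable f z) ->
  exists2 a : R, 0 < a < 1 & f (x + u) - f x = dot (gradient f (x + a *: u)) u.
Proof.
move=> df.
have dl (t : R) : is_diff (t : R^o) (fun r : R^o => x + r *: u) ( *:%R^~ u).
  rewrite -[X in is_diff _ _ X]add0r.
  exact: is_diffD.
have dg (t : R) : is_derive t 1 (fun r : R => f (x + r *: u))
    (dot (gradient f (x + t *: u)) u).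
  have d1 : differentiable (f \o (fun r : R^o => x + r *: u)) t.
    apply: differentiable_comp; last exact: df.
    exact: ex_diff.
  apply: DeriveDef; first exact/derivable1_diffP.
  rewrite deriveE; last exact: d1.
  rewrite diff_comp//=.
  by rewrite diff_val scale1r diff_gradient.
have gc : {within `[0, 1], continuous (fun r : R => f (x + r *: u))}.
  apply: continuous_subspaceT => t.
  apply/differentiable_continuous/derivable1_diffP.
  by have := dg t; case.
have [a a01] := MVT ltr01 (fun t _ => dg t) gc.
rewrite scale1r scale0r addr0 subr0 mulr1 => E.
by exists a; [move: a01; rewrite in_itv|exact: E].
Qed.

Definition continuously_differentiable (R : realType) (n : nat)
    (f : 'cV[R]_n -> R) : Prop :=
  (forall x, differentiable f x) /\ continuous (gradient f).

Lemma twice_differentiable_C1 (R : realType) (n : nat) (f : 'cV[R]_n -> R) :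
  twice_differentiable f -> continuously_differentiable f.
Proof.
by move=> [df dgf]; split => // x; exact: differentiable_continuous.
Qed.

Lemma C1_cvg (R : realType) (n : nat) (f : 'cV[R]_n -> R) (T : Type)
    (G : set_system T) (y : T -> 'cV[R]_n) (xb : 'cV[R]_n) :
  continuously_differentiable f -> y t @[t --> G] --> xb ->
  f (y t) @[t --> G] --> f xb.
Proof.
move=> [df _] yx.
exact: (cvg_comp _ _ yx (differentiable_continuous (df xb))).
Qed.

(* Limits along an arbitrary filter make the quotient converge jointly in the
   base point and the increment, which is what yields uniformity on compacts. *)
Lemma increment_quotient (R : realType) (n : nat) (f : 'cV[R]_n -> R)
    (T : Type) (G : set_system T) {FG : Filter G} (y u : T -> 'cV[R]_n)
    (xb : 'cV[R]_n) :
  continuously_differentiable f ->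
  y t @[t --> G] --> xb -> u t @[t --> G] --> (0 : 'cV[R]_n) ->
  exists2 q : T -> 'cV[R]_n,
    forall t, f (y t + u t) = f (y t) + dot (q t) (u t) &
    q t @[t --> G] --> gradient f xb.
Proof.
move=> [df cf] yx u0.
(* Choice makes the mean value point a function of [t]. *)
have mv t := cid2 (gradient_mean_value (y t) (u t) df).
pose a t : R := s2val (mv t).
have a01 t : 0 < a t < 1 := s2valP (mv t).
exists (fun t => gradient f (y t + a t *: u t)) => [t|].
  by rewrite -(s2valP' (mv t)) addrCA subrr addr0.
suff ya : y t + a t *: u t @[t --> G] --> xb.
  exact: (cvg_comp _ _ ya (cf xb)).
rewrite -[xb]addr0; apply: cvgD => //.
(* [a t] need not converge: [0 < a t < 1] bounds the shift by [u t]. *)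
apply/norm_cvg0P; apply: (@squeeze_cvgr _ _ _ _ (fun=> 0) (fun t => `|u t|)).
- apply: nearW => t; rewrite normr_ge0 normrZ ler_piMl//.
  by have /andP[a0 a1] := a01 t; rewrite ger0_norm ltW.
- exact: cvg_cst.
- exact/norm_cvg0P.
Qed.

(** * Second-order expansion of one step *)

(* Covers both integrators: [c = 0] for the Euler map, [c = 1/2] for the Heun
   map. *)
Definition step_expansion (R : realType) (n : nat)
    (step : ('cV[R]_n -> 'cV[R]_n) -> R -> 'cV[R]_n -> 'cV[R]_n) (c : R) :=
  forall (F : 'cV[R]_n -> R) (l : 'I_n) (T : Type) (G : set_system T)
    (FG : Filter G) (y : T -> 'cV[R]_n) (s : T -> R) (xb : 'cV[R]_n),
  continuously_differentiable F ->
  y t @[t --> G] --> xb -> s t @[t --> G] --> (0 : R) ->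
  exists2 r : T -> R,
    forall t, step (fun x => F x *: unit_vec R n l) (s t) (y t) =
      y t + (s t * (F (y t) + s t * r t)) *: unit_vec R n l &
    r t @[t --> G] --> c * (F xb * gradient F xb l 0).

Lemma euler_step_expansion (R : realType) (n : nat) :
  step_expansion (@euler_map R n) 0.
Proof.
move=> F l T G FG y s xb _ _ _; exists (fun=> 0) => [t|].
  by rewrite mulr0 addr0 /euler_map scalerA.
by rewrite mul0r; exact: cvg_cst.
Qed.

(** The second evaluation is [F y] plus [s * F y] times a quotient tending to the [l]-th partial
    derivative; averaging halves this correction. *)
Lemma heun_step_expansion (R : realType) (n : nat) :
  step_expansion (@heun_map R n) 2^-1.
Proof.
move=> F l T G FG y s xb FC yx s0.
have Fy := C1_cvg FC yx.
have u0 : (s t * F (y t)) *: unit_vec R n l @[t --> G] --> (0 : 'cV[R]_n).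
  rewrite -(scale0r (unit_vec R n l)) -(mul0r (F xb)).
  by apply: cvgZr_tmp; apply: cvgM.
have [q Fq qF] := increment_quotient FC yx u0.
exists (fun t => 2^-1 * (F (y t) * q t l 0)) => [t|].
  rewrite /heun_map scalerA Fq dotZr dot_unit -scalerDl scalerA.
  by congr (_ + _ *: _); field.
by apply: cvgM; [exact: cvg_cst|apply: cvgM => //; exact: cvg_coord].
Qed.

(* Turns the reversed fields of the switching into steps of negative length. *)
Definition odd_step (R : realType) (n : nat)
    (step : ('cV[R]_n -> 'cV[R]_n) -> R -> 'cV[R]_n -> 'cV[R]_n) :=
  forall g s x, step (fun z => - g z) s x = step g (- s) x.

Lemma euler_odd_step (R : realType) (n : nat) : odd_step (@euler_map R n).
Proof. by move=> g s x; rewrite /euler_map scalerN scaleNr. Qed.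

Lemma heun_odd_step (R : realType) (n : nat) : odd_step (@heun_map R n).
Proof.
move=> g s x; rewrite /heun_map -opprD !scalerN !scaleNr.
by rewrite mulNr scaleNr.
Qed.

(** * Expansion of a four-step block and of a full sweep *)

Fixpoint iterate (R : realType) (n : nat)
    (step : ('cV[R]_n -> 'cV[R]_n) -> R -> 'cV[R]_n -> 'cV[R]_n)
    (g : nat -> 'cV[R]_n -> 'cV[R]_n) (s : R) (k : nat) (x : 'cV[R]_n) :
    'cV[R]_n :=
  if k is k'.+1 then step (g k') s (iterate step g s k' x) else x.

Lemma cvg_shift_along (R : realType) (n : nat) (T : Type) (G : set_system T)
    {FG : Filter G} (y e : T -> 'cV[R]_n) (s : T -> R)
    (xb eb : 'cV[R]_n) :
  y t @[t --> G] --> xb -> s t @[t --> G] --> (0 : R) ->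
  e t @[t --> G] --> eb -> y t + s t *: e t @[t --> G] --> xb.
Proof.
move=> yx s0 eE; rewrite -[xb]addr0 -(scale0r eb).
by apply: cvgD => //; exact: cvgZ.
Qed.

(** The first-order terms cancel up to the change of [F1] between steps one and three and of [F2]
    between steps two and four. These changes are of order [s] and give the bracket minus the
    self-interaction terms; the four step remainders add [2 * c] times the latter back. *)
Lemma four_step_block (R : realType) (n : nat)
    (step : ('cV[R]_n -> 'cV[R]_n) -> R -> 'cV[R]_n -> 'cV[R]_n) (c : R)
    (F1 F2 : 'cV[R]_n -> R) (l : 'I_n) (T : Type) (G : set_system T)
    {FG : Filter G} (y : T -> 'cV[R]_n) (s : T -> R) (xb : 'cV[R]_n) :
  step_expansion step c -> odd_step step ->
  continuously_differentiable F1 -> continuously_differentiable F2 ->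
  y t @[t --> G] --> xb -> s t @[t --> G] --> (0 : R) ->
  exists2 w : T -> R,
    forall t, step (fun x => - (F2 x *: unit_vec R n l)) (s t)
      (step (fun x => - (F1 x *: unit_vec R n l)) (s t)
      (step (fun x => F2 x *: unit_vec R n l) (s t)
      (step (fun x => F1 x *: unit_vec R n l) (s t) (y t)))) =
      y t + (s t ^+ 2 * w t) *: unit_vec R n l &
    w t @[t --> G] --> F1 xb * gradient F2 xb l 0 - F2 xb * gradient F1 xb l 0
      - (1 - 2 * c) * (F1 xb * gradient F1 xb l 0 + F2 xb * gradient F2 xb l 0).
Proof.
move=> stepE step_odd C1 C2 yx s0; set e := unit_vec R n l.
have Ns0 : - s t @[t --> G] --> (0 : R) by rewrite -oppr0; exact: cvgN.
have se0 (a : T -> R) (b : R) : a t @[t --> G] --> b ->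
    (s t * a t) *: e @[t --> G] --> (0 : 'cV[R]_n).
  by move=> ab; rewrite -(scale0r e) -(mul0r b); apply: cvgZr_tmp; exact: cvgM.
have near_xb (a : T -> R) (b : R) : a t @[t --> G] --> b ->
    y t + (s t * a t) *: e @[t --> G] --> xb.
  by move=> ab; rewrite -[xb]addr0; apply: cvgD => //; exact: se0 ab.
have s_mul (a : T -> R) (b : R) : a t @[t --> G] --> b ->
    s t * a t @[t --> G] --> (0 : R).
  by move=> ab; rewrite -(mul0r b); exact: cvgM.
(* [s t * tj t] is the displacement along [e] after [j] steps. *)
have [r1 E1 r1c] := stepE F1 l T G FG y s xb C1 yx s0.
pose t1 t := F1 (y t) + s t * r1 t.
have t1c : t1 t @[t --> G] --> F1 xb.
  by rewrite -[F1 xb]addr0; apply: cvgD; [exact: C1_cvg|exact: s_mul r1c].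
pose y1 t := y t + (s t * t1 t) *: e.
have y1c : y1 t @[t --> G] --> xb := near_xb _ _ t1c.
have [r2 E2 r2c] := stepE F2 l T G FG y1 s xb C2 y1c s0.
pose t2 t := t1 t + (F2 (y1 t) + s t * r2 t).
have t2c : t2 t @[t --> G] --> F1 xb + F2 xb.
  apply: cvgD => //; rewrite -[F2 xb]addr0.
  by apply: cvgD; [exact: C1_cvg|exact: s_mul r2c].
pose y2 t := y t + (s t * t2 t) *: e.
have y2c : y2 t @[t --> G] --> xb := near_xb _ _ t2c.
(* A reversed step has length [- s], so its second-order term keeps its sign. *)
have [r3 E3 r3c] := stepE F1 l T G FG y2 (fun t => - s t) xb C1 y2c Ns0.
pose t3 t := t2 t - (F1 (y2 t) - s t * r3 t).
have t3c : t3 t @[t --> G] --> F2 xb.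
  have -> : F2 xb = F1 xb + F2 xb - (F1 xb - 0) by ring.
  apply: cvgB => //.
  by apply: cvgB; [exact: C1_cvg|exact: s_mul r3c].
pose y3 t := y t + (s t * t3 t) *: e.
have y3c : y3 t @[t --> G] --> xb := near_xb _ _ t3c.
have [r4 E4 r4c] := stepE F2 l T G FG y3 (fun t => - s t) xb C2 y3c Ns0.
(* Here [y2] is [y] shifted by [s * t2] along [e], and [y1] is [y3] shifted by [s * (t1 - t3)]: this
   expands the two uncancelled differences of [F1] and [F2]. *)
have [q1 Q1 q1c] := increment_quotient C1 yx (se0 _ _ t2c).
have t13c : t1 t - t3 t @[t --> G] --> F1 xb - F2 xb by exact: cvgB.
have [q2 Q2 q2c] := increment_quotient C2 y3c (se0 _ _ t13c).
exists (fun t => r1 t + r2 t + r3 t + r4 t - t2 t * q1 t l 0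
  + (t1 t - t3 t) * q2 t l 0) => [t|].
  rewrite !step_odd E1 -/(t1 t) -/(y1 t) E2.
  have -> : y1 t + (s t * (F2 (y1 t) + s t * r2 t)) *: e = y2 t.
    by rewrite /y1 /y2 -addrA -scalerDl -mulrDr.
  rewrite E3.
  have -> : y2 t + (- s t * (F1 (y2 t) + - s t * r3 t)) *: e = y3 t.
    rewrite /y2 /y3 -addrA -scalerDl; congr (_ + _ *: _).
    by rewrite /t3; ring.
  rewrite E4 {1}/y3 -addrA -scalerDl; congr (_ + _ *: _).
  have := Q1 t; rewrite -/(y2 t) dotZr dot_unit => F1y2.
  have := Q2 t; rewrite dotZr dot_unit.
  have -> : y3 t + (s t * (t1 t - t3 t)) *: e = y1 t.
    rewrite /y3 /y1 -addrA -scalerDl; congr (_ + _ *: _); ring.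
  move=> F2y1.
  have E : t3 t =
      F1 (y t) + s t * r1 t + F2 (y1 t) + s t * r2 t - F1 (y2 t) + s t * r3 t.
    by rewrite /t3 /t2 /t1; ring.
  rewrite {1}E F2y1 F1y2. ring.
set L := (X in _ --> X).
(* The limit regrouped in the order of the summands of [w]. *)
have -> : L = c * (F1 xb * gradient F1 xb l 0)
    + c * (F2 xb * gradient F2 xb l 0) + c * (F1 xb * gradient F1 xb l 0)
    + c * (F2 xb * gradient F2 xb l 0)
    - (F1 xb + F2 xb) * gradient F1 xb l 0
    + (F1 xb - F2 xb) * gradient F2 xb l 0.
  by rewrite /L; ring.
apply: cvgD; [apply: cvgB; [apply: cvgD; [apply: cvgD;
  [apply: cvgD|]|]|apply: cvgM]|apply: cvgM] => //; exact: cvg_coord.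
Qed.

(** The fourth field is the default value of [nth], reached at [j = 3]. *)
Lemma switched_fieldE (R : realType) (n : nat) (F1 F2 : 'cV[R]_n -> R)
    (l : 'I_n) (j : nat) : (j < 4)%N ->
  switched_field F1 F2 (4 * l + j) =
    nth (fun x => - (F2 x *: unit_vec R n l))
      [:: (fun x => F1 x *: unit_vec R n l); (fun x => F2 x *: unit_vec R n l);
          (fun x => - (F1 x *: unit_vec R n l))] j.
Proof.
move=> j4; apply/funext => x; rewrite /switched_field.
have -> : ((4 * l + j) %% 4 = j)%N by lia.
have -> : ((4 * l + j) %/ 4 = l)%N by lia.
rewrite modn_small//.
by case: j j4 => [|[|[|[|]]]].
Qed.

Lemma switched_field_periodic (R : realType) (n : nat)
    (F1 F2 : 'cV[R]_n -> R) (m k : nat) : (0 < n)%N ->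
  switched_field F1 F2 (m * (4 * n) + k) = switched_field F1 F2 k.
Proof.
move=> n0; apply/funext => x; rewrite /switched_field.
have -> : ((m * (4 * n) + k) %/ 4 = m * n + k %/ 4)%N by lia.
have -> : ((m * (4 * n) + k) %% 4 = k %% 4)%N by lia.
by rewrite modnMDl.
Qed.

(** Induction on the number of coordinates treated: each block starts at [y + s ^+ 2 *: v], which
    still tends to [xb], so it contributes its coordinate of [D xb]. Later [D] is [- gradient J]. *)
Lemma sweep_expansion (R : realType) (n : nat)
    (step : ('cV[R]_n -> 'cV[R]_n) -> R -> 'cV[R]_n -> 'cV[R]_n) (c : R)
    (F1 F2 : 'cV[R]_n -> R) (D : 'cV[R]_n -> 'cV[R]_n)
    (T : Type) (G : set_system T)
    {FG : Filter G} (y : T -> 'cV[R]_n) (s : T -> R) (xb : 'cV[R]_n) :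
  step_expansion step c -> odd_step step ->
  continuously_differentiable F1 -> continuously_differentiable F2 ->
  (forall x, D x = bracket F1 F2 x
    - (1 - 2 * c) *: (F1 x *: gradient F1 x + F2 x *: gradient F2 x)) ->
  y t @[t --> G] --> xb -> s t @[t --> G] --> (0 : R) ->
  exists2 v : T -> 'cV[R]_n,
    forall t, iterate step (switched_field F1 F2) (s t) (4 * n) (y t) =
      y t + s t ^+ 2 *: v t &
    v t @[t --> G] --> D xb.
Proof.
move=> stepE step_odd C1 C2 DE yx s0.
have s20 : s t ^+ 2 @[t --> G] --> (0 : R).
  by rewrite -(mul0r 0); exact: cvgM.
suff H l : (l <= n)%N -> exists2 v : T -> 'cV[R]_n,
    forall t, iterate step (switched_field F1 F2) (s t) (4 * l) (y t) =
      y t + s t ^+ 2 *: v t &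
    v t @[t --> G] --> \sum_(i < n | (i < l)%N) D xb i 0 *: unit_vec R n i.
  have [v vE vc] := H n (leqnn n); exists v => //.
  rewrite (col_sum_unit (D xb)); move: vc.
  by under eq_bigl do rewrite ltn_ord.
elim: l => [_|l IH ln].
  exists (fun=> 0) => [t|]; first by rewrite muln0/= scaler0 addr0.
  by rewrite big_pred0//; exact: cvg_cst.
have [v vE vc] := IH (ltnW ln).
pose o := Ordinal ln.
have [w wE wc] := four_step_block o stepE step_odd C1 C2
  (cvg_shift_along yx s20 vc) s0.
exists (fun t => v t + w t *: unit_vec R n l) => [t|].
  have sw j := @switched_fieldE R n F1 F2 o j.
  have := (sw 0 isT, sw 1 isT, sw 2 isT, sw 3 isT)%N.
  rewrite mulnSr !addnS /= !addn0 vE => swE; rewrite !swE /=.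
  by rewrite wE -addrA scalerDr scalerA.
have -> : \sum_(i < n | (i < l.+1)%N) D xb i 0 *: unit_vec R n i =
    \sum_(i < n | (i < l)%N) D xb i 0 *: unit_vec R n i
    + D xb o 0 *: unit_vec R n l.
  rewrite (bigD1 o)//= addrC; congr (_ + _); apply: eq_bigl => i.
  by rewrite ltnS -(inj_eq val_inj)/=; case: ltngtP.
apply: cvgD => //; apply: cvgZr_tmp; move: wc; rewrite DE !mxE.
exact.
Qed.

(** * Points inside a sweep and along a trajectory *)

Lemma step_cvg (R : realType) (n : nat)
    (step : ('cV[R]_n -> 'cV[R]_n) -> R -> 'cV[R]_n -> 'cV[R]_n) (c : R)
    (F : 'cV[R]_n -> R) (l : 'I_n) (T : Type) (G : set_system T)
    {FG : Filter G} (y : T -> 'cV[R]_n) (s : T -> R) (xb : 'cV[R]_n) :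
  step_expansion step c -> continuously_differentiable F ->
  y t @[t --> G] --> xb -> s t @[t --> G] --> (0 : R) ->
  step (fun x => F x *: unit_vec R n l) (s t) (y t) @[t --> G] --> xb.
Proof.
move=> stepE FC yx s0; have [r rE rc] := stepE F l T G FG y s xb FC yx s0.
under eq_fun do rewrite rE -scalerA.
apply: (cvg_shift_along yx s0); apply: cvgZr_tmp.
by apply: cvgD; [exact: C1_cvg FC yx|exact: cvgM s0 rc].
Qed.

(** Each step moves by [s] times a convergent quantity, so a fixed number of steps does not change
    the limit. *)
Lemma iterate_cvg (R : realType) (n : nat)
    (step : ('cV[R]_n -> 'cV[R]_n) -> R -> 'cV[R]_n -> 'cV[R]_n) (c : R)
    (F1 F2 : 'cV[R]_n -> R) (k : nat) (T : Type) (G : set_system T)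
    {FG : Filter G} (y : T -> 'cV[R]_n) (s : T -> R) (xb : 'cV[R]_n) :
  (0 < n)%N -> step_expansion step c -> odd_step step ->
  continuously_differentiable F1 -> continuously_differentiable F2 ->
  y t @[t --> G] --> xb -> s t @[t --> G] --> (0 : R) ->
  iterate step (switched_field F1 F2) (s t) k (y t) @[t --> G] --> xb.
Proof.
move=> n0 stepE step_odd C1 C2 yx s0; elim: k => //= k IH.
have Ns0 : - s t @[t --> G] --> (0 : R) by rewrite -oppr0; exact: cvgN.
pose l : 'I_n := Ordinal (ltn_pmod (k %/ 4) n0).
have -> : switched_field F1 F2 k = nth (fun x => - (F2 x *: unit_vec R n l))
    [:: (fun x => F1 x *: unit_vec R n l); (fun x => F2 x *: unit_vec R n l);
        (fun x => - (F1 x *: unit_vec R n l))] (k %% 4).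
  apply/funext => x; rewrite /switched_field.
  by case: (k %% 4)%N => [|[|[|[|]]]].
case: (k %% 4)%N => [|[|[|j]]] /=; rewrite ?nth_nil.
- exact: (step_cvg l stepE C1 IH s0).
- exact: (step_cvg l stepE C2 IH s0).
- under eq_fun do rewrite step_odd.
  exact: (step_cvg l stepE C1 IH Ns0).
- under eq_fun do rewrite step_odd.
  exact: (step_cvg l stepE C2 IH Ns0).
Qed.

(** By periodicity, every sweep meets the same fields as the first. *)
Lemma iterate_trajectory (R : realType) (n : nat)
    (step : ('cV[R]_n -> 'cV[R]_n) -> R -> 'cV[R]_n -> 'cV[R]_n)
    (F1 F2 : 'cV[R]_n -> R) (h : R) (x : nat -> 'cV[R]_n) (m k : nat) :
  (0 < n)%N -> is_trajectory step (switched_field F1 F2) h x ->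
  x (m * (4 * n) + k)%N =
  iterate step (switched_field F1 F2) (Num.sqrt h) k (x (m * (4 * n))%N).
Proof.
move=> n0 xE; elim: k => [|k IH] /=; first by rewrite addn0.
by rewrite addnS xE IH switched_field_periodic.
Qed.

(** * Euclidean norm, compactness and distance to a set *)

Lemma enorm_ge0 (R : realType) (n : nat) (x : 'cV[R]_n) : 0 <= enorm x.
Proof. exact: sqrtr_ge0. Qed.

Lemma enorm0 (R : realType) (n : nat) : enorm (0 : 'cV[R]_n) = 0.
Proof.
by rewrite /enorm big1 ?sqrtr0// => i _; rewrite mxE expr0n.
Qed.

Lemma coord_le_enorm (R : realType) (n : nat) (x : 'cV[R]_n) (i : 'I_n) :
  `|x i 0| <= enorm x.
Proof.
rewrite -sqrtr_sqr; apply: ler_wsqrtr; rewrite (bigD1 i)//= lerDl.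
by apply: sumr_ge0 => j _; exact: sqr_ge0.
Qed.

Lemma cvg_enorm (R : realType) (n : nat) (T : Type) (G : set_system T)
    {FG : Filter G} (f : T -> 'cV[R]_n) (a : 'cV[R]_n) :
  f t @[t --> G] --> a -> enorm (f t) @[t --> G] --> enorm a.
Proof.
move=> fa; have sc : \sum_i f t i 0 ^+ 2 @[t --> G] --> \sum_i a i 0 ^+ 2.
  apply: cvg_big => [|i _]; first by move=> z; exact: add_continuous.
  by apply: cvgM; exact: cvg_coord.
exact: (cvg_comp _ _ sc (@sqrt_continuous R _)).
Qed.

Lemma enorm_continuous (R : realType) (n : nat) (a : 'cV[R]_n) :
  continuous (fun x : 'cV[R]_n => enorm (x - a)).
Proof.
move=> x; apply: (@cvg_enorm R n _ (nbhs x) _ (fun z => z - a)).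
by apply: cvgB; [exact: cvg_id|exact: cvg_cst].
Qed.

(** Transposition carries a compact box of row vectors onto a box of columns containing the closed
    set [A]. *)
Lemma bounded_closed_compact_col (R : realType) (n : nat)
    (A : set 'cV[R]_n) (r : 'I_n -> R) :
  closed A -> (forall x, A x -> forall i, `|x i 0| <= r i) -> compact A.
Proof.
move=> clA Ar.
have box : compact [set v : 'rV[R]_n | forall i, `[- r i, r i]%classic (v 0 i)].
  apply: rV_compact (fun i => `[- r i, r i]%classic) _ => i.
  exact: segment_compact.
have tr : continuous (fun v : 'rV[R]_n => v^T).
  move=> v; apply: (@cvg_col R n _ (nbhs v)) => i.
  under eq_fun do rewrite mxE.
  by rewrite mxE; exact: coord_continuous.
apply: (subclosed_compact clA
  (continuous_compact (continuous_subspaceT tr) box)) => x Ax.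
exists x^T; last by rewrite trmxK.
move=> i; rewrite /= mxE in_itv/= -ler_norml; exact: Ar.
Qed.

Lemma continuous_le_closed (R : realType) (V : topologicalType) (f : V -> R)
    (a : R) : continuous f -> closed [set x | f x <= a].
Proof.
by move=> cf; apply: (preimage_closed _ (@closed_le R a)) => x _; exact: cf.
Qed.

Lemma continuous_ge_closed (R : realType) (V : topologicalType) (f : V -> R)
    (a : R) : continuous f -> closed [set x | a <= f x].
Proof.
by move=> cf; apply: (preimage_closed _ (@closed_ge R a)) => x _; exact: cf.
Qed.

Lemma sublevel_compact (R : realType) (n : nat) (J : 'cV[R]_n -> R) (M : R) :
  continuous J -> radially_unbounded J -> compact [set x | J x <= M].
Proof.
move=> cJ /(_ M)[r rP]; apply: (@bounded_closed_compact_col _ _ _ (fun=> r)).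
  exact: continuous_le_closed.
move=> x /= Jx i; apply: le_trans (coord_le_enorm x i) _.
by rewrite leNgt; apply: contraTN Jx => /rP; rewrite ltNge.
Qed.

Lemma compact_eball (R : realType) (n : nat) (a : 'cV[R]_n) (r : R) :
  compact (eball a r).
Proof.
apply: (@bounded_closed_compact_col _ _ _ (fun i => r + `|a i 0|)).
  by apply: continuous_le_closed; exact: enorm_continuous.
move=> x /= xr i; have := coord_le_enorm (x - a) i; rewrite !mxE => xa.
rewrite -lerBlDr; apply: le_trans (le_trans xa xr).
exact: lerB_dist.
Qed.

(** The distance is exactly 0 at points of [A], so the sequence of distances is eventually
    constant. *)
Lemma cvg_to_set_eventually_in (R : realType) (n : nat) (x : nat -> 'cV[R]_n)
    (A : set 'cV[R]_n) : (\forall k \near \oo, A (x k)) -> cvg_to_set x A.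
Proof.
move=> xA; apply: cvg_near_cst; apply: filterS xA => k Ak.
rewrite /dist_to_set; apply/eqP; rewrite eq_le; apply/andP; split.
  apply: ge_inf; last by exists (x k) => //; rewrite subrr enorm0.
  by exists 0 => _ [y _ <-]; exact: enorm_ge0.
apply: lb_le_inf; last by move=> _ [y _ <-]; exact: enorm_ge0.
by exists (enorm (x k - x k)); exists (x k).
Qed.

(** * Strict minimum and uniform decrease over a sweep *)

(** The mean value point on the segment from [xs] to [x] differs from [xs] by a positive multiple of
    [x - xs], where the gradient hypothesis gives the sign. *)
Lemma gt_minimum (R : realType) (n : nat) (J : 'cV[R]_n -> R)
    (xs : 'cV[R]_n) :
  (forall x, differentiable J x) ->
  (forall x, x <> xs -> 0 < dot (gradient J x) (x - xs)) ->
  forall x, x <> xs -> J xs < J x.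
Proof.
move=> dJ hgrad x xxs.
have [a /andP[a0 _]] := gradient_mean_value xs (x - xs) dJ.
rewrite addrCA subrr addr0 -subr_gt0 => ->.
have axs : xs + a *: (x - xs) <> xs.
  move=> /eqP; rewrite -subr_eq0 addrAC subrr add0r scaler_eq0 gt_eqF//=.
  by rewrite subr_eq0 => /eqP.
have := hgrad _ axs.
by rewrite addrAC subrr add0r dotZr pmulr_rgt0.
Qed.

Lemma gradient_neq0 (R : realType) (n : nat) (J : 'cV[R]_n -> R)
    (xs x : 'cV[R]_n) :
  0 < dot (gradient J x) (x - xs) -> gradient J x != 0.
Proof.
apply: contraTneq => ->; rewrite dotE big1 ?ltxx// => i _.
by rewrite mxE mul0r.
Qed.

Lemma near0_gt0 (R : realType) (P : R -> Prop) :
  (\forall s \near (0 : R), P s) ->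
  exists2 e : R, 0 < e & forall s, 0 < s < e -> P s.
Proof.
move=> /nbhs_ballP[e /= e0 eP]; exists e => // s /andP[s0 se].
by apply: eP; rewrite /ball/= sub0r normrN gtr0_norm.
Qed.

(** Covering compactness turns a property holding jointly near each [(xb, 0)] into one uniform on
    [K]. The parameter is a step size or a margin. *)
Lemma uniform_small_step (R : realType) (n : nat) (K : set 'cV[R]_n)
    (P : R -> 'cV[R]_n -> Prop) : compact K ->
  (forall xb, K xb ->
     \forall t \near filter_prod (nbhs xb) (nbhs (0 : R)), P t.2 t.1) ->
  \forall s \near (0 : R), K `<=` P s.
Proof.
move=> /compact_near_coveringP cK KP.
by apply: (cK _ (nbhs (0 : R)) P) => xb /KP.
Qed.

(** A sweep changes [J] by [s ^+ 2 * dot q v], and [dot q v] tends to minus the squared gradient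
    norm, which is below [- eta] on [K]. *)
Lemma sweep_decrease (R : realType) (n : nat)
    (step : ('cV[R]_n -> 'cV[R]_n) -> R -> 'cV[R]_n -> 'cV[R]_n) (c : R)
    (F1 F2 J : 'cV[R]_n -> R) (K : set 'cV[R]_n) :
  step_expansion step c -> odd_step step ->
  continuously_differentiable F1 -> continuously_differentiable F2 ->
  continuously_differentiable J ->
  (forall x, - gradient J x = bracket F1 F2 x
    - (1 - 2 * c) *: (F1 x *: gradient F1 x + F2 x *: gradient F2 x)) ->
  compact K -> (forall x, K x -> gradient J x != 0) ->
  exists2 eta : R, 0 < eta & \forall s \near (0 : R), forall x, K x ->
    J (iterate step (switched_field F1 F2) s (4 * n) x) <= J x - s ^+ 2 * eta.
Proof.
move=> stepE step_odd C1 C2 CJ JE cK K0.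
pose N x := dot (gradient J x) (gradient J x).
have cN : continuous N.
  by move=> x; apply: (@cvg_dot R n _ (nbhs x)); exact: (CJ.2 x).
have [eta eta0 etaK] : exists2 eta : R, 0 < eta & forall x, K x -> eta < N x.
  have : \forall eta \near (0 : R), K `<=` [set x | eta < N x].
    apply: (uniform_small_step (P := fun eta x => eta < N x) cK) => xb Kxb.
    set G := filter_prod _ _.
    have Nx : N t.1 @[t --> G] --> N xb.
      have yx : t.1 @[t --> G] --> xb by exact: cvg_fst.
      exact: (cvg_comp _ _ yx (cN xb)).
    have s0 : t.2 @[t --> G] --> (0 : R) by exact: cvg_snd.
    have Nxb : 0 < N xb by apply/dot_gt0/K0.
    (* The midpoint separates the candidate bound [t.2] from [N t.1]. *)
    have N2 : 0 < N xb / 2 < N xb by lra.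
    have /andP[N20 N21] := N2.
    apply: filterS2 (cvgr_gt _ Nx _ N21) (cvgr_lt _ s0 _ N20) => t.
    by move=> /[swap]; exact: lt_trans.
  move=> /near0_gt0[e e0 eP]; exists (e / 2); first by rewrite divr_gt0.
  by apply: eP; lra.
exists eta => //; apply: (uniform_small_step cK) => xb Kxb.
set G := filter_prod _ _.
have yx : t.1 @[t --> G] --> xb by exact: cvg_fst.
have s0 : t.2 @[t --> G] --> (0 : R) by exact: cvg_snd.
have [v vE vc] := sweep_expansion stepE step_odd C1 C2 JE yx s0.
have s2v : t.2 ^+ 2 *: v t @[t --> G] --> (0 : 'cV[R]_n).
  rewrite -(scale0r (- gradient J xb)) -(mul0r 0); apply: cvgZ => //.
  exact: cvgM.
have [q qE qc] := increment_quotient CJ yx s2v.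
have qvc : dot (q t) (v t) @[t --> G] --> - N xb.
  by rewrite /N -dotNr; exact: cvg_dot.
have : \forall t \near G, dot (q t) (v t) < - eta.
  by apply: (cvgr_lt _ qvc); rewrite ltrN2; exact: etaK.
apply: filterS => t qv; rewrite vE qE dotZr lerD2l -mulrN.
by rewrite ler_wpM2l ?sqr_ge0 ?ltW.
Qed.

(** * Practical convergence of the switched scheme *)

(** Levels [J xs < b < a <= M] are used: sweeps descend between [b] and [M], and cannot climb from
    below [b] past [a], so the sublevel set of [a] is invariant under sweeps. *)
Lemma practical_convergence (R : realType) (n : nat)
    (step : ('cV[R]_n -> 'cV[R]_n) -> R -> 'cV[R]_n -> 'cV[R]_n) (c : R)
    (F1 F2 J : 'cV[R]_n -> R) (xs : 'cV[R]_n) :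
  (0 < n)%N -> step_expansion step c -> odd_step step ->
  continuously_differentiable F1 -> continuously_differentiable F2 ->
  continuously_differentiable J ->
  (forall x, - gradient J x = bracket F1 F2 x
    - (1 - 2 * c) *: (F1 x *: gradient F1 x + F2 x *: gradient F2 x)) ->
  radially_unbounded J ->
  (forall x, x <> xs -> 0 < dot (gradient J x) (x - xs)) ->
  practically_convergent step (switched_field F1 F2) xs.
Proof.
move=> n0 stepE step_odd C1 C2 CJ JE radJ hgrad d1 d2 d20 d21.
have cJ : continuous J.
  by move=> x; exact: (differentiable_continuous (CJ.1 x)).
have [M M1 MxsM] : exists2 M, forall x, eball xs d1 x -> J x <= M & J xs < M.
  have := continuous_compact (continuous_subspaceT cJ)
    (@compact_eball R n xs d1).
  move=> /compact_bounded[B [_ BP]].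
  have {}BP x : eball xs d1 x -> J x <= B + 1.
    move=> xd; apply: le_trans (ler_norm _) _.
    by apply: (BP (B + 1)); [rewrite ltrDl|exists x].
  (* The second entry makes [J xs < M] strict. *)
  exists (Num.max (B + 1) (J xs + 1)) => [x /BP Jx|].
    by rewrite le_max Jx.
  by rewrite lt_max [X in _ || X]ltrDl ltr01 orbT.
(* On the compact part of the sublevel set of [M] at distance at least [d2] from [xs], [J] exceeds
   [J xs] by a uniform margin. *)
have [a [aJ aM] aP] : exists2 a, J xs < a /\ a <= M &
    forall x, J x <= a -> enorm (x - xs) < d2.
  have cA : compact ([set x | J x <= M] `&` [set x | d2 <= enorm (x - xs)]).
    apply: compact_closedI; first exact: sublevel_compact.
    by apply: continuous_ge_closed; exact: enorm_continuous.
  have : \forall s \near (0 : R), [set x | J x <= M] `&`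
      [set x | d2 <= enorm (x - xs)] `<=` [set x | J xs + s < J x].
    apply: (uniform_small_step (P := fun s x => J xs + s < J x) cA).
    move=> xb [_ /= xbd2]; set G := filter_prod _ _.
    have Jx : J t.1 - t.2 @[t --> G] --> J xb - 0.
      apply: cvgB; last exact: cvg_snd.
      have yx : t.1 @[t --> G] --> xb by exact: cvg_fst.
      exact: (cvg_comp _ _ yx (cJ xb)).
    have Jxb : J xs < J xb - 0.
      rewrite subr0; apply: (gt_minimum CJ.1 hgrad) => xbE.
      by move: xbd2; rewrite xbE subrr enorm0 leNgt d20.
    by apply: filterS (cvgr_gt _ Jx _ Jxb) => t; rewrite ltrBrDr.
  move=> /near0_gt0[e e0 eP].
  pose d := Num.min (e / 2) (M - J xs).
  have d0 : 0 < d by rewrite lt_min divr_gt0//= subr_gt0.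
  have de : d < e.
    by apply: le_lt_trans (_ : e / 2 < e); [rewrite ge_min lexx|lra].
  have dM : J xs + d <= M by rewrite -lerBrDl ge_min lexx orbT.
  exists (J xs + d); first by split=> //; rewrite ltrDl.
  move=> x Jx; rewrite ltNge; apply/negP => xd2.
  have de0 : 0 < d < e by rewrite d0.
  by have /= := eP d de0 x (conj (le_trans Jx dM) xd2); rewrite ltNge Jx.
pose b := (J xs + a) / 2.
have [bJ ba] : J xs < b /\ b < a by split; rewrite /b; lra.
pose g := switched_field F1 F2.
have [eta eta0 dec] : exists2 eta : R, 0 < eta & \forall s \near (0 : R),
    forall x, b <= J x -> J x <= M ->
    J (iterate step g s (4 * n) x) <= J x - s ^+ 2 * eta.
  have cA : compact ([set x | J x <= M] `&` [set x | b <= J x]).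
    apply: compact_closedI; first exact: sublevel_compact.
    exact: continuous_ge_closed.
  have A0 x : ([set x | J x <= M] `&` [set x | b <= J x]) x ->
      gradient J x != 0.
    move=> [_ /= bx]; apply: (@gradient_neq0 _ _ _ xs); apply: hgrad => xxs.
    by move: bx; rewrite xxs leNgt bJ.
  have [eta eta0 H] := sweep_decrease stepE step_odd C1 C2 CJ JE cA A0.
  by exists eta => //; apply: filterS H => s H x bx xM; apply: H.
(* The descent estimate covers only levels from [b] up; below, continuity in the step suffices. *)
have near_b : \forall s \near (0 : R), forall x, J x <= b ->
    J (iterate step g s (4 * n) x) <= a.
  apply: (uniform_small_step (sublevel_compact cJ radJ)
    (P := fun s x => J (iterate step g s (4 * n) x) <= a)) => xb /= xbb.
  set G := filter_prod _ _.
  have yx : t.1 @[t --> G] --> xb by exact: cvg_fst.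
  have s0 : t.2 @[t --> G] --> (0 : R) by exact: cvg_snd.
  have FG : Filter G by exact: filter_prod_filter.
  have /(_ FG) itc := iterate_cvg (4 * n) n0 stepE step_odd C1 C2 yx s0.
  have Jc := C1_cvg CJ itc.
  by apply: filterS (cvgr_lt _ Jc _ (le_lt_trans xbb ba)) => t /ltW.
have inside : \forall s \near (0 : R), forall x, J x <= a ->
    forall j : 'I_(4 * n), enorm (iterate step g s j x - xs) < d2.
  apply: (uniform_small_step (sublevel_compact cJ radJ) (P := fun s x =>
    forall j : 'I_(4 * n), enorm (iterate step g s j x - xs) < d2)).
  move=> xb /= xba.
  set G := filter_prod _ _.
  have yx : t.1 @[t --> G] --> xb by exact: cvg_fst.
  have s0 : t.2 @[t --> G] --> (0 : R) by exact: cvg_snd.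
  (* Finitely many positions [j] share one neighbourhood. *)
  apply: filter_forall => j.
  have FG : Filter G by exact: filter_prod_filter.
  have /(_ FG) itc := iterate_cvg j n0 stepE step_odd C1 C2 yx s0.
  have ec := cvg_comp _ _ itc (@enorm_continuous R n xs xb).
  exact: (cvgr_lt _ ec _ (aP _ xba)).
have [e e0 eP] : exists2 e : R, 0 < e & forall s, 0 < s < e ->
    [/\ (forall x, b <= J x -> J x <= M ->
           J (iterate step g s (4 * n) x) <= J x - s ^+ 2 * eta),
        (forall x, J x <= b -> J (iterate step g s (4 * n) x) <= a) &
        (forall x, J x <= a ->
           forall j : 'I_(4 * n), enorm (iterate step g s j x - xs) < d2)].
  have [e e0 eP] := near0_gt0 (filterI dec (filterI near_b inside)).
  by exists e => // s /eP[H1 [H2 H3]].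
(* The step is [s = sqrt h], so [h < e ^+ 2] means [s < e]. *)
exists (e ^+ 2); first exact: exprn_gt0.
move=> h h0 he x x0 xE.
pose s := Num.sqrt h.
have s0 : 0 < s by rewrite sqrtr_gt0.
have se : 0 < s < e.
  by rewrite s0 -(ger0_norm (ltW e0)) -sqrtr_sqr ltr_sqrt// exprn_gt0.
have {eP}[dec_s near_b_s inside_s] := eP s se.
pose y m := x (m * (4 * n))%N.
have yS m : y m.+1 = iterate step g s (4 * n) (y m).
  by rewrite /y mulSnr (iterate_trajectory m (4 * n) n0 xE).
have s2eta : 0 < s ^+ 2 * eta by rewrite mulr_gt0 ?exprn_gt0.
(* Either level [a] has been reached, or each of the [m] sweeps has lowered [J] by
   [s ^+ 2 * eta]. *)
have yP m : J (y m) <= M /\ (J (y m) <= a \/ J (y m) <= M - s ^+ 2 * eta *+ m).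
  elim: m => [|m [yM IH]].
    by rewrite mulr0n subr0 /y mul0n; split; [|right]; exact: M1.
  rewrite yS; have [yb|/ltW yb] := leP (J (y m)) b.
    by have := near_b_s _ yb => ya; split; [exact: le_trans ya aM|left].
  have Jy := dec_s _ yb yM; rewrite mulrSr; split; first by lra.
  by case: IH => IH; [left|right]; lra.
have [N NP] : exists N, M - s ^+ 2 * eta *+ N <= a.
  exists (Num.bound ((M - a) / (s ^+ 2 * eta))).
  rewrite lerBlDr -lerBlDl -mulr_natr mulrC -ler_pdivrMr//.
  by apply/ltW/archi_boundP; rewrite divr_ge0 ?subr_ge0// ltW.
have ya m : (N <= m)%N -> J (y m) <= a.
  move=> Nm; have [_ [//|ym]] := yP m.
  apply: le_trans ym (le_trans _ NP).
  by rewrite lerD2l lerN2 ler_wpMn2l// ltW.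
apply: cvg_to_set_eventually_in; exists (N * (4 * n))%N => // k /= Nk.
have n4 : (0 < 4 * n)%N by rewrite muln_gt0.
(* The quotient counts completed sweeps, the remainder is the position inside the current one. *)
rewrite (divn_eq k (4 * n)) (iterate_trajectory _ _ n0 xE) /eball/=.
apply/ltW/(inside_s _ _ (Ordinal (ltn_pmod k n4))).
by apply: ya; rewrite leq_divRL.
Qed.

Theorem theorem2 (R : realType) (n : nat) (hn : (1 <= n)%N)
    (J : 'cV[R]_n -> R) (f1 f2 : R -> R) (F1 F2 : 'cV[R]_n -> R)
    (xs : 'cV[R]_n)
    (hJ : twice_differentiable J)
    (hF1f : forall x, F1 x = f1 (J x)) (hF2f : forall x, F2 x = f2 (J x))
    (hF1 : twice_differentiable F1) (hF2 : twice_differentiable F2)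
    (hrad : radially_unbounded J)
    (hgrad : forall x : 'cV[R]_n, x <> xs ->
       0 < ((gradient J x)^T *m (x - xs)) 0 0) :
  ((forall x : 'cV[R]_n,
      - gradient J x =
        bracket F1 F2 x - F1 x *: gradient F1 x - F2 x *: gradient F2 x) ->
   practically_convergent (@euler_map R n) (switched_field F1 F2) xs)
  /\
  ((forall x : 'cV[R]_n, - gradient J x = bracket F1 F2 x) ->
   practically_convergent (@heun_map R n) (switched_field F1 F2) xs).
Proof.
have C1 := twice_differentiable_C1 hF1.
have C2 := twice_differentiable_C1 hF2.
have CJ := twice_differentiable_C1 hJ.
split=> JE.
(* Here [c = 0], so [1 - 2 * c] is 1 and both self-interaction terms remain. *)
- apply: (practical_convergence hn (@euler_step_expansion R n)
    (@euler_odd_step R n) C1 C2 CJ _ hrad hgrad) => x.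
  by rewrite JE mulr0 subr0 scale1r opprD addrA.
(* Here [c = 1/2], so [1 - 2 * c] vanishes and only the bracket remains. *)
- apply: (practical_convergence hn (@heun_step_expansion R n)
    (@heun_odd_step R n) C1 C2 CJ _ hrad hgrad) => x.
  by rewrite JE mulfV ?pnatr_eq0// subrr scale0r subr0.
Qed.
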